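(* Let $\varphi(x_1,x_2,\dots)$ be an arbitrary symmetric function (an element of the algebra $\Lambda$ of symmetric functions over $\mathbb R$) and define the function $G_\varphi$ on the set $\mathbb Y$ of all Young diagrams by $$G_\varphi(\lambda)=\varphi(c_1(\lambda),\dots,c_{|\lambda|}(\lambda),0,0,\dots),\qquad \lambda\in\mathbb Y.$$ Then the Plancherel average $\langle G_\varphi\rangle_n$ is a polynomial function of $n$ (i.e. there is a polynomial $P\in\mathbb R[t]$ with $\langle G_\varphi\rangle_n=P(n)$ for all $n\ge1$).
   Context: $\mathbb Y$ is the set of all Young diagrams (integer partitions); $\mathbb Y_n$ is the set of diagrams with $n$ boxes. For $\lambda\in\mathbb Y$, $|\lambda|$ is its number of boxes and $\dim\lambda$ is the number of standard Young tableaux of shape $\lambda$. The content of the box in row $i$ and column $j$ is $j-i$; $c_1(\lambda),\dots,c_{|\lambda|}(\lambda)$ are the contents of the boxes of $\lambda$ in any order. The Plancherel measure on $\mathbb Y_n$ is $M_n(\lambda)=(\dim\lambda)^2/n!$, and for a function $F$ on $\mathbb Y$, its $n$th Plancherel average is $\langle F\rangle_n=\sum_{\lambda\in\mathbb Y_n}\frac{(\dim\lambda)^2}{n!}F(\lambda)$. *)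

(* Defs.v *)
From HB Require Import structures.
From mathcomp Require Import all_boot all_order all_algebra.
Set Implicit Arguments. Unset Strict Implicit. Unset Printing Implicit Defensive.
Import Order.TTheory GRing.Theory Num.Theory.

Definition is_partition (l : seq nat) : bool :=
  sorted geq l && all (fun k => 0 < k) l.

Definition psize (l : seq nat) : nat := sumn l.

Definition in_diagram (l : seq nat) (b : nat * nat) : bool :=
  (b.1 < size l) && (b.2 < nth 0 l b.1).

Definition contents (l : seq nat) : seq int :=
  flatten [seq [seq (j%:Z - i%:Z)%R | j <- iota 0 (nth 0 l i)] | i <- iota 0 (size l)].

(* Standard Young tableaux of shape lambda, n = |lambda|: a bijection T from
   labels {0,..,n-1} to the boxes of lambda (T k = box containing label k+1),
   increasing along rows and columns (i.e. b <= b' componentwise implies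
   label(b) <= label(b')).  Boxes lie in 'I_n * 'I_n since rows, cols < n. *)
Definition is_SYT (l : seq nat) (T : {ffun 'I_(psize l) -> 'I_(psize l) * 'I_(psize l)}) : bool :=
  [&& injectiveb T,
      [forall k, in_diagram l (nat_of_ord (T k).1, nat_of_ord (T k).2)] &
      [forall k, forall k', (((T k).1 <= (T k').1)%N && ((T k).2 <= (T k').2)%N) ==> (k <= k')%N]].

Definition dimY (l : seq nat) : nat := #|[pred T | @is_SYT l T]|.

(* Young diagrams with n boxes, indexed by nonincreasing n-tuples of
   'I_(n.+1) with sum n; the diagram is the list of positive entries. *)
Definition tuple_to_part (n : nat) (t : n.-tuple 'I_n.+1) : seq nat :=
  map (@nat_of_ord n.+1) (filter (fun i : 'I_n.+1 => (0 < i)%N) t).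

Definition is_Yn_tuple (n : nat) (t : n.-tuple 'I_n.+1) : bool :=
  sorted geq (map (@nat_of_ord n.+1) t) && (sumn (map (@nat_of_ord n.+1) t) == n).

Local Open Scope ring_scope.

(* Monomial symmetric function m_mu evaluated at (x_1,..,x_n,0,0,...):
   sum of x^alpha over all distinct exponent vectors alpha in N^n whose
   nonzero entries, sorted decreasingly, equal mu. *)
Definition mono_eval (R : nzRingType) (mu : seq nat) (xs : seq R) : R :=
  \sum_(a : {ffun 'I_(size xs) -> 'I_(sumn mu).+1}
         | sort geq (map (fun i => nat_of_ord (a i)) (filter (fun i => (0 < a i)%N) (enum 'I_(size xs)))) == mu)
     \prod_(i < size xs) (nth 0 xs i) ^+ (a i).

(* An element of the algebra Lambda of symmetric functions over R, written in
   the monomial basis as a finite linear combination sum_k c_k m_{mu_k}. *)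
Definition symfun (R : nzRingType) := seq (R * seq nat).

Definition is_symfun (R : nzRingType) (phi : symfun R) : bool :=
  all (fun p => is_partition p.2) phi.

Definition symfun_eval (R : nzRingType) (phi : symfun R) (xs : seq R) : R :=
  \sum_(p <- phi) p.1 * mono_eval p.2 xs.

Definition G_phi (R : nzRingType) (phi : symfun R) (l : seq nat) : R :=
  symfun_eval phi [seq (c%:~R : R) | c <- contents l].

Definition planch_avg (R : fieldType) (F : seq nat -> R) (n : nat) : R :=
  \sum_(t : n.-tuple 'I_n.+1 | is_Yn_tuple t)
     ((dimY (tuple_to_part t))%:R ^+ 2 / (n`!)%:R) * F (tuple_to_part t).

(* Main.v *)
(* The diagrams grow by Plancherel growth: adding a box to [l] in row [i] has
   probability [dim (l + box) / ((n + 1) dim l)], so the average at level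
   [n + 1] is the average at level [n] of the conditional expectation.  By the
   Frobenius dimension formula this probability is the residue at [c_i] of
   [prod_{j < n} (z - c_j + 1) / prod_{j <= n} (z - c_j)], where [c_i = l_i - i]
   is the content of the first box missing from row [i]; hence the
   [k]-th moment of the content of the new box is a complete symmetric function
   of a difference of two alphabets, and Newton's identities make it a
   polynomial in the power sums of the contents of [l].  Give the [j]-th power
   sum degree [j + 2]; the [k]-th moment has degree at most [k].  Adding a box
   of content [c] replaces [p_j] by [p_j + c ^ j], so the difference of the
   averages of [F] at levels [n + 1] and [n] is the average of a function of
   smaller degree, and polynomiality in [n] follows by induction. *)
Require Import Defs.
From HB Require Import structures.
From mathcomp Require Import all_boot all_order all_algebra.
From mathcomp Require Import zify ring lra.
Set Implicit Arguments. Unset Strict Implicit. Unset Printing Implicit Defensive.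
Import Order.TTheory GRing.Theory Num.Theory.

(** * Partitions and their corners *)

Lemma geq_trans : transitive geq.
Proof. by move=> y x z /= yx zy; apply: leq_trans zy yx. Qed.

Lemma sorted_nth (s : seq nat) :
  sorted geq s <-> (forall i, nth 0 s i.+1 <= nth 0 s i).
Proof.
split=> [/(sortedP 0) H i|H]; last by apply/(sortedP 0) => i _; apply: H.
by case: (ltnP i.+1 (size s)) => [/H //|h]; rewrite (nth_default _ h).
Qed.

Lemma sorted_nth_le (s : seq nat) i j :
  sorted geq s -> i <= j -> nth 0 s j <= nth 0 s i.
Proof.
move=> /sorted_nth H; elim: j => [|j IH]; first by rewrite leqn0 => /eqP->.
by rewrite leq_eqVlt => /predU1P[->//|/IH]; apply: leq_trans (H j).
Qed.

Definition trim (s : seq nat) := [seq x <- s | 0 < x].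

Lemma sorted_trim (s : seq nat) : sorted geq s ->
  s = trim s ++ nseq (size s - size (trim s)) 0.
Proof.
elim: s => //= -[|x] s IH ps /=; last first.
  by rewrite subSS -IH ?(path_sorted ps).
have s0 : all (pred1 0) s.
  by have := order_path_min geq_trans ps; apply: sub_all => y /=; rewrite leqn0.
have -> : trim s = [::].
  by apply/eqP; rewrite -size_eq0 size_filter -leqn0 leqNgt -has_count; apply/hasPn => y /(allP s0)/eqP->.
by rewrite subn0 /=; congr cons; apply/all_pred1P.
Qed.

Lemma trim_partition (s : seq nat) : sorted geq s -> is_partition (trim s).
Proof.
move=> ss; rewrite /is_partition filter_all andbT.
exact: sorted_filter geq_trans _ _ ss.
Qed.

Lemma nth_trim (s : seq nat) i : sorted geq s -> nth 0 (trim s) i = nth 0 s i.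
Proof.
move=> /sorted_trim {2}->; rewrite nth_cat; case: ltnP => // h.
by rewrite nth_nseq nth_default //; case: ifP.
Qed.

Lemma sumn_trim (s : seq nat) : sumn (trim s) = sumn s.
Proof. by elim: s => //= -[|x] s /= ->. Qed.

Lemma partition_sorted l : is_partition l -> sorted geq l.
Proof. by case/andP. Qed.

Lemma partition_nth_gt0 l i : is_partition l -> (0 < nth 0 l i) = (i < size l).
Proof.
case/andP=> _ /(all_nthP 0) pl; case: (ltnP i (size l)) => h; first exact: pl.
by rewrite nth_default.
Qed.

Lemma partition_ext l l' : is_partition l -> is_partition l' ->
  nth 0 l =1 nth 0 l' -> l = l'.
Proof.
move=> pl pl' e; apply: (@eq_from_nth _ 0) => //.
have le k k' : is_partition k -> is_partition k' -> nth 0 k =1 nth 0 k' -> size k <= size k'.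
  by move=> pk pk' e'; rewrite leqNgt -(partition_nth_gt0 _ pk) e' nth_default.
by apply/eqP; rewrite eqn_leq !le // => i; rewrite e.
Qed.

Lemma partition_size_le l : is_partition l -> size l <= sumn l.
Proof.
case/andP=> _; elim: l => //= -[|x] l IH //= h.
by rewrite addSn ltnS (leq_trans (IH h)) // leq_addl.
Qed.

Lemma partition_nth_le l i : nth 0 l i <= sumn l.
Proof.
elim: l i => [|x l IH] [|i] //=; first exact: leq_addr.
exact: leq_trans (IH i) (leq_addl _ _).
Qed.

Lemma sumn0_partition l : is_partition l -> sumn l = 0 -> l = [::].
Proof. by move=> /partition_size_le h e; move: h; rewrite e; case: l {e}. Qed.

Definition corner l i := nth 0 l i.+1 < nth 0 l i.
Definition addable l i := (i == 0) || (nth 0 l i < nth 0 l i.-1).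
(** Trimming deletes a row whose only box is removed, so that no zero part survives. *)
Definition decr l i := trim (set_nth 0 l i (nth 0 l i).-1).

Lemma corner_size l i : corner l i -> i < size l.
Proof. by rewrite /corner; case: (ltnP i (size l)) => // h; rewrite !nth_default // ltnW. Qed.

Lemma addable_size l i : addable l i -> i <= size l.
Proof.
rewrite /addable; case: i => //= i; case: (ltnP i (size l)) => // h.
by rewrite (nth_default _ h).
Qed.

Section Decr.
Variables (l : seq nat) (i : nat).
Hypotheses (pl : is_partition l) (ci : corner l i).

Let s := set_nth 0 l i (nth 0 l i).-1.

Let nth_s j : nth 0 s j = nth 0 l j - (i == j).
Proof.
rewrite nth_set_nth /= eq_sym; case: eqP => [->|_]; last by rewrite subn0.
by rewrite subn1.
Qed.

Let sorted_s : sorted geq s.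
Proof.
apply/sorted_nth => j; rewrite !nth_s.
have /sorted_nth /(_ j) := partition_sorted pl.
by case: (i =P j) ci => [->|_ _]; rewrite /corner; case: eqP => /=; lia.
Qed.

Lemma nth_decr j : nth 0 (decr l i) j = nth 0 l j - (i == j).
Proof. by rewrite nth_trim ?nth_s. Qed.

Lemma decr_partition : is_partition (decr l i).
Proof. exact: trim_partition. Qed.

Lemma sumn_decr : sumn (decr l i) = (sumn l).-1.
Proof.
rewrite sumn_trim sumn_set_nth0.
have := partition_nth_le l i; move: ci; rewrite /corner; lia.
Qed.

Lemma size_decr : size (decr l i) <= size l.
Proof.
by rewrite size_filter (leq_trans (count_size _ _)) // size_set_nth geq_max leqnn corner_size.
Qed.

End Decr.

Lemma incr_partition l i : is_partition l -> addable l i -> is_partition (incr_nth l i).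
Proof.
move=> pl ai; apply/andP; split.
  apply/sorted_nth => j; rewrite !nth_incr_nth.
  have /sorted_nth /(_ j) := partition_sorted pl.
  by case: (i =P j.+1) ai => [->|_ _]; rewrite /addable /=; case: eqP => /=; lia.
apply/(all_nthP 0) => j; rewrite size_incr_nth nth_incr_nth => h.
case: eqP => //= ij; rewrite add0n partition_nth_gt0 //; move: h.
move: ij; have := addable_size ai; case: (ltnP i (size l)); lia.
Qed.

Lemma corner_incr l i : addable l i -> is_partition l -> corner (incr_nth l i) i.
Proof.
move=> ai pl; rewrite /corner !nth_incr_nth eqxx; have /sorted_nth /(_ i) := partition_sorted pl.
by case: eqP; lia.
Qed.

Lemma decr_incr l i : is_partition l -> addable l i -> decr (incr_nth l i) i = l.
Proof.
move=> pl ai; have pi := incr_partition pl ai; have ci := corner_incr ai pl.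
apply: partition_ext => //; first exact: decr_partition.
by move=> j; rewrite nth_decr // nth_incr_nth addnC addnK.
Qed.

Lemma addable_decr l i : is_partition l -> corner l i -> addable (decr l i) i.
Proof.
move=> pl ci; rewrite /addable !nth_decr // eqxx.
case: i ci => //= i; have /sorted_nth /(_ i) := partition_sorted pl.
by rewrite /corner; case: eqP; lia.
Qed.

Lemma incr_decr l i : is_partition l -> corner l i -> incr_nth (decr l i) i = l.
Proof.
move=> pl ci; apply: partition_ext => //.
  by apply: incr_partition; [apply: decr_partition | apply: addable_decr].
move=> j; rewrite nth_incr_nth nth_decr //; case: eqP => [<-|_] /=; last by rewrite subn0.
by move: ci; rewrite /corner; lia.
Qed.

Lemma sumn_incr l i : sumn (incr_nth l i) = (sumn l).+1.
Proof.
elim: l i => [|x l IH] [|i] //=; last by rewrite IH addnS.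
by elim: i => //=.
Qed.

(** * Counting standard tableaux *)

Lemma in_diagramE l b : in_diagram l b = (b.2 < nth 0 l b.1).
Proof. by rewrite /in_diagram; case: ltnP => // h; rewrite nth_default. Qed.

(* A standard tableau read as the list of its boxes in the order of their
   labels: no box may weakly dominate a later one. *)
Definition SYT_word l (s : seq (nat * nat)) :=
  [&& size s == sumn l, all (in_diagram l) s &
      pairwise (fun b' b => ~~ ((b.1 <= b'.1) && (b.2 <= b'.2))) s].

(** Recursion on the box with the largest label: it ends a corner row, and the other labels form a
    tableau of the diagram without it. *)
Fixpoint SYT_words n l : seq (seq (nat * nat)) :=
  if n is n'.+1 then
    [seq rcons s (i, (nth 0 l i).-1) | i <- [seq i <- iota 0 (size l) | corner l i],
                                       s <- SYT_words n' (decr l i)]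
  else [:: [::]].

Definition boxes l := [seq (i, j) | i <- iota 0 (size l), j <- iota 0 (nth 0 l i)].

Lemma mem_boxes l b : (b \in boxes l) = in_diagram l b.
Proof.
apply/allpairsPdep/idP => [[i [j [+ + ->]]]|/andP[h1 h2]].
  by rewrite !mem_iota /in_diagram /= !add0n => -> ->.
by exists b.1, b.2; rewrite !mem_iota; split; case: b h1 h2.
Qed.

Lemma size_boxes l : size (boxes l) = sumn l.
Proof.
rewrite size_allpairs_dep; congr sumn.
rewrite (eq_map (fun i => size_iota 0 _)).
by apply: (@eq_from_nth _ 0) => [|i]; rewrite size_map size_iota // => h; rewrite (nth_map 0) ?size_iota // nth_iota.
Qed.

(** The boxes of a word are distinct and as many as the diagram has, so they exhaust it. Hence the
    right and lower neighbours of the last box, which would dominate it, lie outside the diagram. *)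
Lemma SYT_word_rcons l s x : is_partition l ->
  SYT_word l (rcons s x) <->
  [/\ corner l x.1, x.2 = (nth 0 l x.1).-1 & SYT_word (decr l x.1) s].
Proof.
move=> pl; have sl := partition_sorted pl; split.
- case/and3P => sz; rewrite all_rcons pairwise_rcons => /andP[xl sl'] /andP[xm pw].
  have us : uniq (rcons s x).
    apply: (@pairwise_uniq _ (fun b' b => ~~ ((b.1 <= b'.1) && (b.2 <= b'.2)))).
      by move=> b; rewrite /= !leqnn.
    by rewrite pairwise_rcons xm.
  have full b : in_diagram l b -> b \in rcons s x.
    have sub : {subset rcons s x <= boxes l}.
      move=> c; rewrite mem_rcons inE mem_boxes => /predU1P[->//|].
      exact: (allP sl').
    have le : size (boxes l) <= size (rcons s x) by rewrite size_boxes (eqP sz).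
    by rewrite -mem_boxes (uniq_min_size us sub le).2.
  have nmax b : in_diagram l b -> x.1 <= b.1 -> x.2 <= b.2 -> b = x.
    move=> /full; rewrite mem_rcons inE => /predU1P[//|bs] h1 h2.
    by have := allP xm _ bs; rewrite /= h1 h2.
  have x2 : x.2 = (nth 0 l x.1).-1.
    move: xl; rewrite in_diagramE => xl.
    case: (ltnP x.2.+1 (nth 0 l x.1)) => h; last by lia.
    have := nmax (x.1, x.2.+1); rewrite in_diagramE /= h leqnn leqnSn => /(_ isT isT isT).
    by case: (x) => a b []; lia.
  have cx : corner l x.1.
    move: xl; rewrite /corner in_diagramE => xl.
    case: (ltnP x.2 (nth 0 l x.1.+1)) => h; last by lia.
    have := nmax (x.1.+1, x.2); rewrite in_diagramE /= h leqnn leqnSn => /(_ isT isT isT).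
    by case: (x) => a b []; lia.
  split => //; apply/and3P; split=> //.
    by rewrite sumn_decr // -(eqP sz) size_rcons.
  apply/allP => b bs; have := allP sl' _ bs; rewrite !in_diagramE nth_decr //.
  case: eqP => [e|_]; last by rewrite subn0.
  (* The last box of this row is [x] itself, which cannot occur twice. *)
  move=> h; rewrite subn1 ltn_neqAle -ltnS prednK ?h ?andbT; last by apply: leq_trans h.
  apply/eqP => e2; move: us; rewrite rcons_uniq.
  by rewrite [x]surjective_pairing x2 e -e2 -surjective_pairing bs.
- case=> cx x2 /and3P[/eqP sz al pw]; have cx' := cx; rewrite /corner in cx'.
  have xl : in_diagram l x by rewrite in_diagramE x2; lia.
  apply/and3P; split.
  + rewrite size_rcons sz sumn_decr // prednK //.
    by apply: leq_trans (partition_nth_le l x.1); apply: leq_ltn_trans cx'.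
  + rewrite all_rcons xl; apply: sub_all al => b; rewrite !in_diagramE nth_decr //.
    by move=> h; apply: leq_trans h (leq_subr _ _).
  + rewrite pairwise_rcons pw andbT; apply: sub_all al => b; rewrite /= in_diagramE => h.
    (* Row [b.1] of the smaller diagram is no longer than its row [x.1], which stops just before
       column [x.2]. *)
    apply/negP => /andP[h1 h2].
    have := sorted_nth_le (partition_sorted (decr_partition pl cx)) h1.
    by rewrite [leqRHS]nth_decr // eqxx; move: h h2; rewrite x2 /=; lia.
Qed.

Lemma SYT_wordsP n l s : is_partition l -> sumn l = n ->
  (s \in SYT_words n l) = SYT_word l s.
Proof.
elim: n l s => [|n IH] l s pl sl.
  rewrite /SYT_word sl inE size_eq0; case: eqP => // ->.
  by rewrite (sumn0_partition pl sl).
apply/allpairsPdep/idP => [[i [s' []]]|].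
  rewrite mem_filter => /andP[ci _]; have pd := decr_partition pl ci.
  by rewrite IH ?sumn_decr ?sl // => ws ->; apply/SYT_word_rcons.
case/lastP: s => [|s x]; first by rewrite /SYT_word sl.
move=> /(SYT_word_rcons _ _ pl)[cx x2 ws]; exists x.1, s; split.
- by rewrite mem_filter cx mem_iota corner_size.
- by rewrite IH ?decr_partition ?sumn_decr ?sl.
- by rewrite -x2 -surjective_pairing.
Qed.

Lemma SYT_words_uniq n l : uniq (SYT_words n l).
Proof.
elim: n l => //= n IH l; apply: allpairs_uniq_dep; first by rewrite filter_uniq ?iota_uniq.
  by move=> *; apply: IH.
move=> [i s] [i' s'] _ _ /= /eqP; rewrite eqseq_rcons => /andP[/eqP -> /eqP[->]] //.
Qed.

Lemma dimY_words l : is_partition l -> dimY l = size (SYT_words (sumn l) l).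
Proof.
move=> pl; pose n := psize l.
pose f (T : {ffun 'I_n -> 'I_n * 'I_n}) := [seq (nat_of_ord (T k).1, nat_of_ord (T k).2) | k <- enum 'I_n].
have szf T : size (f T) = n by rewrite size_map size_enum_ord.
have nthf T (k : 'I_n) : nth (0, 0) (f T) k = (nat_of_ord (T k).1, nat_of_ord (T k).2).
  by rewrite (nth_map k) ?size_enum_ord ?nth_ord_enum.
have fi : injective f.
  move=> T T' e; apply/ffunP => k; have := nthf T k; rewrite e nthf.
  by case: (T k) (T' k) => a b [a' b'] /= [/val_inj-> /val_inj->].
have SYT_E T : SYT_word l (f T) = is_SYT T.
  rewrite /SYT_word /is_SYT szf eqxx /=.
  have -> : all (in_diagram l) (f T) = [forall k, in_diagram l (nat_of_ord (T k).1, nat_of_ord (T k).2)].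
    rewrite all_map; apply/allP/forallP => H k; last by move=> _; apply: H.
    by apply: H; rewrite mem_enum.
  rewrite andbCA; congr andb.
  (* Injectivity follows from monotonicity: equal boxes dominate each other, so their labels are
     ordered both ways. *)
  apply/(pairwiseP (0, 0))/andP => [H|[_ /forallP H] i j].
    have H' (k k' : 'I_n) : (T k).1 <= (T k').1 -> (T k).2 <= (T k').2 -> k <= k'.
      move=> h1 h2; case: leqP => // lt.
      by have := H k' k; rewrite !inE szf !ltn_ord lt !nthf /= h1 h2 => /(_ isT isT isT).
    split; last by apply/forallP => k; apply/forallP => k'; apply/implyP => /andP[]; apply: H'.
    apply/injectiveP => k k' e; apply/val_inj/eqP.
    by rewrite eqn_leq; apply/andP; split; apply: H'; rewrite e.
  rewrite !inE szf => hi hj ij; rewrite (nthf _ (Ordinal hi)) (nthf _ (Ordinal hj)) /=.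
  apply/negP => h; have /forallP /(_ (Ordinal hi)) := H (Ordinal hj).
  by rewrite h /= leqNgt ij.
rewrite /dimY cardE -(size_map f); apply/perm_size/uniq_perm.
- by rewrite map_inj_uniq ?enum_uniq.
- exact: SYT_words_uniq.
move=> s; rewrite SYT_wordsP //; apply/mapP/idP => [[T]|ws].
  by rewrite mem_enum inE -SYT_E => ws ->.
case/and3P: (ws) => /eqP sz /allP al _.
have bnd b : b \in s -> (b.1 < n) && (b.2 < n).
  move=> /al /andP[h1 h2]; rewrite (leq_trans h1) ?partition_size_le //.
  by rewrite (leq_trans h2) ?partition_nth_le.
(* The default value [k] of [insubd] is never taken, since [bnd] keeps both coordinates below
   [n]. *)
pose T := [ffun k : 'I_n => (insubd k (nth (0, 0) s k).1, insubd k (nth (0, 0) s k).2)].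
have fT : s = f T.
  apply: (@eq_from_nth _ (0, 0)); rewrite ?szf // => k; rewrite sz => kn.
  have /bnd /andP[h1 h2] : nth (0, 0) s k \in s by rewrite mem_nth // sz.
  by rewrite (nthf _ (Ordinal kn)) ffunE /= !val_insubd h1 h2 -surjective_pairing.
by exists T; rewrite ?mem_enum ?inE -?SYT_E -?fT.
Qed.

Lemma dimY_nil : dimY [::] = 1.
Proof. by rewrite dimY_words. Qed.

(** Branching rule on the position of the largest label. The range [m] may exceed the number of
    rows, to match the free number of nodes in the Frobenius formula. *)
Lemma dimY_rec l m : is_partition l -> 0 < sumn l -> size l <= m ->
  dimY l = \sum_(i < m | corner l i) dimY (decr l i).
Proof.
move=> pl l0 lm; rewrite dimY_words // -(prednK l0) /=.
rewrite size_allpairs_dep sumnE big_map big_filter.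
rewrite -(big_mkord (corner l) (fun i => dimY (decr l i))) (big_cat_nat (n := size l)) //=.
rewrite [X in _ = _ + X]big1_seq ?addn0; last first.
  by move=> i /andP[/corner_size h]; rewrite mem_index_iota leqNgt h.
rewrite /index_iota subn0; apply: eq_bigr => i ci.
by rewrite dimY_words ?sumn_decr ?decr_partition.
Qed.

Lemma dimY_gt0 l : is_partition l -> 0 < dimY l.
Proof.
move: {2}(sumn l) (erefl (sumn l)) => n; elim: n l => [|n IH] l sl pl.
  by rewrite (sumn0_partition pl sl) dimY_nil.
have c : corner l (size l).-1.
  have s0 : 0 < size l by case: (l) sl.
  by rewrite /corner prednK // (nth_default _ (leqnn _)) partition_nth_gt0 // prednK.
have h : (size l).-1 < (size l).+1 by rewrite ltnS leq_pred.
rewrite (@dimY_rec l (size l).+1) ?sl // (bigD1 (Ordinal h)) //= addn_gt0 IH //.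
  by rewrite sumn_decr // sl.
exact: decr_partition.
Qed.

Local Open Scope ring_scope.

(** * Newton's identities for a difference of alphabets *)

Section Newton.
Variable F : fieldType.
Implicit Types (x y : nat -> F) (m k : nat).

Definition distinct x m := forall i j, (i < m)%N -> (j < m)%N -> x i = x j -> i = j.

(** The derivative at [x i] of the monic polynomial with the first [m] nodes as roots: a Lagrange
    denominator. *)
Definition nodal x m i : F := \prod_(j < m | j != i :> nat) (x i - x j).

Lemma nodal_neq0 x m i : distinct x m -> (i < m)%N -> nodal x m i != 0.
Proof.
move=> dx lim; apply/prodf_neq0 => j ji; rewrite subr_eq0.
by apply: contra ji => /eqP /dx -> //.
Qed.

Lemma nodal_recr x m i : (i < m)%N -> nodal x m.+1 i = nodal x m i * (x i - x m).
Proof. by move=> im; rewrite /nodal big_mkcond big_ord_recr /= -big_mkcond /= gtn_eqF. Qed.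

(** Compare coefficients of degree [m] in the Lagrange interpolation formula; the numerators [b i]
    are monic of that degree. *)
Lemma lagrange_lead (p : {poly F}) x m : distinct x m.+1 -> (size p <= m.+1)%N ->
  \sum_(i < m.+1) p.[x i] / nodal x m.+1 i = p`_m.
Proof.
move=> dx sp.
pose b (i : 'I_m.+1) : {poly F} := \prod_(j < m.+1 | j != i) ('X - (x j)%:P).
have bE i : b i = \prod_(j <- enum [pred j | j != i]) ('X - (x j)%:P).
  by rewrite big_enum; apply: eq_bigl => j; rewrite inE.
have szb i : size (b i) = m.+1.
  rewrite bE size_prod_XsubC -cardE; congr _.+1.
  by have := cardC1 i; rewrite card_ord /= => e; rewrite -[RHS]e; apply: eq_card.
have lb i : (b i)`_m = 1.
  by have /monicP := monic_prod_XsubC (index_enum _) (fun j => j != i) (fun j : 'I_m.+1 => x j); rewrite /lead_coef -/(b i) szb.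
pose q := \sum_(i < m.+1) (p.[x i] / nodal x m.+1 i) *: b i.
have sq : (size q <= m.+1)%N.
  apply: (leq_trans (size_sum _ _ _)); apply/bigmax_leqP => i _.
  by rewrite (leq_trans (size_scale_leq _ _)) ?szb.
have -> : \sum_(i < m.+1) p.[x i] / nodal x m.+1 i = q`_m.
  by rewrite coef_sum; apply: eq_bigr => i _; rewrite coefZ lb mulr1.
suff qp : q = p by rewrite qp.
apply/eqP; rewrite -subr_eq0; apply/eqP.
apply: (@roots_geq_poly_eq0 _ _ [seq x i | i <- iota 0 m.+1]).
- apply/allP => _ /mapP[k + ->]; rewrite mem_iota /= add0n => km.
  rewrite rootE hornerD hornerN horner_sum (bigD1 (Ordinal km)) //= big1 ?addr0.
    rewrite hornerZ horner_prod.
    under eq_bigr do rewrite hornerXsubC.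
    by rewrite divfK ?subrr // nodal_neq0.
  move=> i ik; rewrite hornerZ horner_prod (bigD1 (Ordinal km)) 1?eq_sym //=.
  by rewrite hornerXsubC subrr mul0r mulr0.
- by rewrite map_inj_in_uniq ?iota_uniq // => i j; rewrite !mem_iota; apply: dx.
- by rewrite size_map size_iota (leq_trans (size_polyD _ _)) // size_polyN geq_max sq sp.
Qed.

(* The complete symmetric functions of the virtual alphabet
   x_0 + ... + x_m - y_0 - ... - y_{m-1}. *)
Definition superh x y m k : F :=
  \sum_(i < m.+1) x i ^+ k * (\prod_(j < m) (x i - y j)) / nodal x m.+1 i.

Lemma superh0 x y m : distinct x m.+1 -> superh x y m 0 = 1.
Proof.
move=> dx; pose p : {poly F} := \prod_(j < m) ('X - (y j)%:P).
have sp : size p = m.+1 by rewrite size_prod_XsubC /index_enum -enumT size_enum_ord.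
transitivity p`_m.
  rewrite -(lagrange_lead dx) ?sp //; apply: eq_bigr => i _.
  rewrite expr0 mul1r horner_prod; congr (_ / _); apply: eq_bigr => j _.
  by rewrite hornerXsubC.
by have /monicP := monic_prod_XsubC (index_enum _) xpredT (fun j : 'I_m => y j); rewrite /lead_coef -/p sp.
Qed.

(** Multiplying each term by [x i - x m] kills the last node and cancels its factor in the other
    denominators. *)
Lemma superh_lower x y m k : distinct x m.+1 ->
  superh x y m k.+1 - x m * superh x y m k =
  \sum_(i < m) x i ^+ k * (\prod_(j < m) (x i - y j)) / nodal x m i.
Proof.
move=> dx; rewrite /superh mulr_sumr -sumrB big_ord_recr /= exprS !mulrA subrr addr0.
apply: eq_bigr => i _; rewrite exprS nodal_recr //.
have n0 : nodal x m i != 0 by apply: nodal_neq0 => // a b /leqW am /leqW bm; apply: dx.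
have : x i - x m != 0.
  by rewrite subr_eq0; apply/eqP => /(dx i m (ltnW (ltn_ord i)) (leqnn _)) e; have := ltn_ord i; rewrite e ltnn.
by move=> d0; field; apply/andP.
Qed.

Lemma superh_raise x y m k :
  superh x y m k.+1 - y m * superh x y m k =
  \sum_(i < m.+1) x i ^+ k * (\prod_(j < m.+1) (x i - y j)) / nodal x m.+1 i.
Proof.
rewrite /superh mulr_sumr -sumrB; apply: eq_bigr => i _.
by rewrite big_ord_recr /= exprS; ring.
Qed.

(** Dropping the node [x m.+1] from the larger alphabet and adjoining [y m] to the smaller one give
    the same sum. For the generating series this reads [(1 - x_{m+1} z) H_{m+1}(z) = (1 - y_m z)
    H_m(z)]. *)
Lemma superh_step x y m k : distinct x m.+2 ->
  superh x y m.+1 k.+1 =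
  x m.+1 * superh x y m.+1 k + superh x y m k.+1 - y m * superh x y m k.
Proof.
move=> dx; have := superh_lower y k dx; rewrite -superh_raise => e.
by rewrite -addrA -e addrC subrK.
Qed.

Definition psum_diff x y m k : F := \sum_(i < m.+1) x i ^+ k - \sum_(i < m) y i ^+ k.

(** The coefficients of [S(z) = T(z) (1 - b z) / (1 - a z)], by expanding the geometric series. *)
Lemma geom_unroll (t s : nat -> F) (a b : F) : t 0%N = 1 -> s 0%N = 1 ->
    (forall k, s k.+1 = a * s k + t k.+1 - b * t k) ->
  forall k, s k = \sum_(j < k) a ^+ j * (t (k - j)%N - b * t (k - j.+1)%N) + a ^+ k.
Proof.
move=> t0 s0 st; elim=> [|k IH]; first by rewrite big_ord0 add0r expr0.
rewrite st {}IH big_ord_recl /= expr0 mul1r subn0 subn1 /= exprS mulrDr mulr_sumr.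
rewrite (eq_bigr (fun j : 'I_k => a ^+ bump 0 j * (t (k.+1 - bump 0 j)%N - b * t (k.+1 - (bump 0 j).+1)%N))); first by ring.
by move=> j _; rewrite /bump /= add1n !subSS exprS mulrA.
Qed.

(** Induction on [m]: adjoining the pair [x m.+1], [y m] multiplies the generating series as in
    [superh_step] and adds [a ^+ j - b ^+ j] to the power sums. An inner induction on [k] then
    matches coefficients. *)
Lemma superh_newton x y m k : distinct x m.+1 ->
  k%:R * superh x y m k = \sum_(j < k) psum_diff x y m j.+1 * superh x y m (k - j.+1).
Proof.
elim: m k => [|m IHm] k dx.
  have tE i : superh x y 0 i = x 0%N ^+ i.
    by rewrite /superh /nodal big_ord1 big_ord0 big_pred0 ?mulr1 ?divr1 // => -[[]].
  under eq_bigr => j _ do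
    rewrite /psum_diff big_ord1 big_ord0 subr0 /= tE -exprD subnKC //.
  by rewrite sumr_const card_ord tE mulr_natl.
have dx' : distinct x m.+1 by move=> a b /leqW am /leqW bm; apply: dx.
have {IHm} IHm i := IHm i dx'.
have st i := superh_step y i dx.
have t0 := superh0 y dx'; have s0 := superh0 y dx.
have PE j : psum_diff x y m.+1 j = psum_diff x y m j + x m.+1 ^+ j - y m ^+ j.
  by rewrite /psum_diff !big_ord_recr /=; ring.
have ux := geom_unroll t0 s0 st.
(* Taking [a = b = y m] makes the recursion trivial and unrolls [t] itself; this evaluates the
   geometric sum in [b] that appears below. *)
have uy0 (u v : F) : u = v + u - v by ring.
have uy := @geom_unroll _ _ (y m) (y m) t0 t0 (fun k => uy0 _ _).
move: st t0 s0 IHm PE ux uy.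
move: (superh x y m) (superh x y m.+1) (psum_diff x y m) (psum_diff x y m.+1).
move: (x m.+1) (y m) => a b t s P P' st t0 s0 IHm PE ux uy.
elim: k => [|k IHk]; first by rewrite big_ord0 mul0r.
rewrite big_ord_recr /= subnn s0 mulr1.
have -> : \sum_(j < k) P' j.+1 * s (k.+1 - j.+1)%N =
  a * (\sum_(j < k) P' j.+1 * s (k - j.+1)%N)
  + (\sum_(j < k) P j.+1 * t (k.+1 - j.+1)%N)
  - b * (\sum_(j < k) P j.+1 * t (k - j.+1)%N)
  + a * (\sum_(j < k) a ^+ j * (t (k - j)%N - b * t (k - j.+1)%N))
  - b * (\sum_(j < k) b ^+ j * (t (k - j)%N - b * t (k - j.+1)%N)).
  rewrite !mulr_sumr -!sumrN -!big_split /=; apply: eq_bigr => j _.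
  by rewrite subSS -(subnSK (ltn_ord j)) st (PE j.+1) !exprS; ring.
rewrite -IHk -IHm st PE.
have := IHm k.+1; rewrite big_ord_recr /= subnn t0 mulr1 => e.
have -> : \sum_(j < k) P j.+1 * t (k.+1 - j.+1)%N = k.+1%:R * t k.+1 - P k.+1.
  by rewrite e addrK.
move: (ux k) (uy k); move: (\sum_(j < k) _) (\sum_(j < k) _) => X Y -> ->.
by rewrite -natr1 !exprS; ring.
Qed.

End Newton.

(** * The Frobenius dimension formula *)

Section Frobenius.
Variable R : realFieldType.
Implicit Types (x y : nat -> R) (m k : nat) (l : seq nat).

Definition vdm m x : R := \prod_(i < m) \prod_(j < m | (i < j)%N) (x i - x j).

Lemma vdm_split m k x : (k < m)%N ->
  vdm m x = (-1) ^+ k * nodal x m k *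
    \prod_(i < m | i != k :> nat) \prod_(j < m | (i < j)%N && (j != k :> nat)) (x i - x j).
Proof.
move=> km; pose k' := Ordinal km.
rewrite /vdm (bigD1 k') //=.
have -> : \prod_(i < m | i != k') \prod_(j < m | (i < j)%N) (x i - x j) =
    \prod_(i < m | i != k :> nat) ((if (i < k)%N then x i - x k else 1) *
      \prod_(j < m | (i < j)%N && (j != k :> nat)) (x i - x j)).
  apply: eq_bigr => i; rewrite -val_eqE /= => ik; case: ifP => ltik.
    by rewrite (bigD1 k').
  by rewrite mul1r; apply: eq_bigl => j /=; move: ik ltik; lia.
rewrite big_split /= mulrA; congr (_ * _).
rewrite -big_mkcondr /nodal [in RHS](bigID (fun j : 'I_m => (k < j)%N)) /= mulrCA; congr (_ * _).
  by apply: eq_bigl => j /=; lia.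
rewrite (eq_bigl (fun j : 'I_m => (j < k)%N)); last first.
  by move=> j /=; lia.
rewrite [in RHS](eq_bigl (fun j : 'I_m => (j < k)%N)); last by move=> j /=; lia.
rewrite (eq_bigr (fun j : 'I_m => - (x k - x j))) => [|j _]; last by rewrite opprB.
rewrite prodrN; congr (_ ^+ _ * _).
by rewrite -sum1_card -(big_ord_widen m (fun=> 1%N)) ?sum1_card ?card_ord // ltnW.
Qed.

(** Factors of the Vandermonde product not involving index [k] are unchanged, and the sign
    [(-1) ^+ k] from [vdm_split] is common to both sides. *)
Lemma vdm_update m k x x' : (k < m)%N -> (forall j, j != k -> x' j = x j) ->
  vdm m x' * nodal x m k = vdm m x * \prod_(j < m | j != k :> nat) (x' k - x j).
Proof.
move=> km e; rewrite (vdm_split x' km) (vdm_split x km) /nodal.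
rewrite (eq_bigr (fun j : 'I_m => x' k - x j)); last by move=> j jk; rewrite (e j).
set A := \prod_(i < m | _) _; set B := \prod_(i < m | _) _.
set C := \prod_(i < m | _) _; set D := \prod_(i < m | _) _.
have -> : A = C; last by ring.
by apply: eq_bigr => i ik; apply: eq_bigr => j /andP[_ jk]; rewrite (e i) // (e j).
Qed.

Definition rcont l i : R := (nth 0%N l i)%:R - i%:R.

Lemma rcont_lt l i j : is_partition l -> (i < j)%N -> rcont l j < rcont l i.
Proof.
move=> /partition_sorted sl ij; have := sorted_nth_le sl (ltnW ij); rewrite /rcont.
move: ij; rewrite -(ltr_nat R) -(ler_nat R); lra.
Qed.

Lemma rcont_distinct l m : is_partition l -> distinct (rcont l) m.
Proof.
move=> pl i j _ _ e; apply/eqP; case: ltngtP => // /(rcont_lt pl); by rewrite e ltxx.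
Qed.

(** The Frobenius value of [dim l / |l|!] using [m] rows. The shifted parts in the factorials differ
    from [rcont] by the constant [m - 1], so both have the same Vandermonde product. *)
Definition frob m l : R := vdm m (rcont l) / \prod_(i < m) ((nth 0%N l i + (m.-1 - i))`!)%:R.

Lemma frob_incr m l k : (k < m)%N -> is_partition l ->
  frob m (incr_nth l k) * (rcont l k + m%:R) * nodal (rcont l) m k =
  frob m l * \prod_(j < m | j != k :> nat) (rcont l k + 1 - rcont l j).
Proof.
move=> km pl; rewrite /frob.
have e j : j != k -> rcont (incr_nth l k) j = rcont l j.
  by move=> jk; rewrite /rcont nth_incr_nth eq_sym (negbTE jk).
have := vdm_update km e.
have -> : rcont (incr_nth l k) k = rcont l k + 1.
  by rewrite /rcont nth_incr_nth eqxx /= add1n -natr1; ring.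
have facE l' : \prod_(i < m) ((nth 0%N l' i + (m.-1 - i))`!)%:R =
    ((nth 0%N l' k + (m.-1 - k))`!)%:R *
    \prod_(i < m | i != k :> nat) ((nth 0%N l' i + (m.-1 - i))`!)%:R :> R.
  by rewrite (bigD1 (Ordinal km)).
rewrite !facE nth_incr_nth eqxx add1n addSn factS natrM.
have -> : \prod_(i < m | i != k :> nat) ((nth 0%N (incr_nth l k) i + (m.-1 - i))`!)%:R =
    \prod_(i < m | i != k :> nat) ((nth 0%N l i + (m.-1 - i))`!)%:R :> R.
  by apply: eq_bigr => i ik; rewrite nth_incr_nth eq_sym (negbTE ik).
have -> : (nth 0%N l k + (m.-1 - k)).+1%:R = rcont l k + m%:R.
  have -> : m%:R = (m.-1 - k)%:R + k%:R + 1 :> R by rewrite -natrD natr1; congr _%:R; lia.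
  by rewrite /rcont -natr1 natrD; ring.
set V := vdm _ _; set V' := vdm _ _; set P := \prod_(i < m | _) _%:R; set N := nodal _ _ _.
set Q := \prod_(i < m | _) _; set f := (_`!)%:R; set s := rcont _ _ + _.
move=> E.
have s0 : s != 0.
  have := ler0n R (nth 0%N l k); have : k%:R < m%:R :> R by rewrite ltr_nat.
  by rewrite /s /rcont => h1 h2; rewrite gt_eqF //; lra.
have f0 : f != 0 by rewrite pnatr_eq0 -lt0n fact_gt0.
have P0 : P != 0 by apply/prodf_neq0 => i _; rewrite pnatr_eq0 -lt0n fact_gt0.
apply: (@mulIf _ (f * P)); first by rewrite mulf_neq0.
transitivity (V' * Q); last by field; rewrite P0 f0.
by rewrite -E; field; rewrite P0 f0 s0.
Qed.

Lemma sum_nat_ord m : \sum_(i < m) (i%:R : R) = m%:R * (m%:R - 1) / 2.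
Proof.
elim: m => [|m IH]; first by rewrite big_ord0 mul0r mul0r.
by rewrite big_ord_recr /= IH -natr1; field.
Qed.

(** This identity makes the Frobenius formula compatible with the branching rule. Its left side is
    [h_1 - h_2] of a difference of alphabets, which Newton's identities evaluate from two power
    sums. *)
Lemma down_identity m x : (forall i, (i < m)%N -> 0 <= x i) -> distinct x m ->
  \sum_(i < m) x i * (\prod_(j < m | j != i :> nat) (x i - 1 - x j)) / nodal x m i =
  \sum_(i < m) x i - m%:R * (m%:R - 1) / 2.
Proof.
move=> x0 dx.
(* The extra node 1 differs from every [- x i <= 0], and [superh_lower] removes it again. Each
   factor [X i - Y i] equals 1. *)
pose X i := if (i < m)%N then - x i else 1; pose Y i := X i - 1.
have dX : distinct X m.+1.
  move=> i j; rewrite !ltnS /X => im jm.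
  case: (ltnP i m) => h; case: (ltnP j m) => h'.
  - by move=> /oppr_inj; apply: dx.
  - by move=> e; exfalso; have := x0 _ h; lra.
  - by move=> e; exfalso; have := x0 _ h'; lra.
  - by move=> _; apply/eqP; rewrite eqn_leq (leq_trans im h') (leq_trans jm h).
have XE (i : 'I_m) : X i = - x i by rewrite /X ltn_ord.
have := superh_lower Y 1 dX.
have t0 := superh0 Y dX.
have := superh_newton Y 1 dX; have := superh_newton Y 2 dX.
rewrite !big_ord_recl !big_ord0 /= t0 !addr0 !mulr1 mul1r => n2 n1.
have P1 : psum_diff X Y m 1 = m%:R + 1.
  rewrite /psum_diff big_ord_recr /= addrAC -sumrB /Y.
  rewrite (eq_bigr (fun=> 1)) => [|i _]; last by rewrite !expr1; ring.
  by rewrite sumr_const card_ord /X ltnn.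
have P2 : psum_diff X Y m 2 = - 2 * (\sum_(i < m) x i) - m%:R + 1.
  rewrite /psum_diff big_ord_recr /= addrAC -sumrB /Y.
  rewrite (eq_bigr (fun i : 'I_m => - 2 * x i - 1)) => [|i _]; last by rewrite XE; ring.
  by rewrite sumrB -mulr_sumr sumr_const card_ord /X ltnn expr1n.
have Xm : X m = 1 by rewrite /X ltnn.
rewrite Xm => E.
rewrite (eq_bigr (fun i : 'I_m => - (X i ^+ 1 * \prod_(j < m) (X i - Y j) / nodal X m i))).
  by rewrite sumrN -E; move: n2; rewrite n1 /= P1 P2; lra.
move=> i _; rewrite XE expr1 !mulNr opprK -!mulrA; congr (_ * _).
have -> : nodal X m i = \prod_(j < m | j != i :> nat) - (x i - x j).
  by apply: eq_bigr => j _; rewrite !XE; ring.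
have -> : \prod_(j < m) (- x i - Y j) = \prod_(j < m | j != i :> nat) - (x i - 1 - x j).
  rewrite (bigD1 i) //= {1}/Y XE opprB addrC subrK mul1r.
  by apply: eq_bigr => j _; rewrite /Y !XE; ring.
rewrite -!prodf_div; apply: eq_bigr => j _.
by rewrite invrN mulrNN.
Qed.

Lemma prod_shift m i : \prod_(j < m | (i < j)%N) (j%:R - i%:R) = ((m.-1 - i)`!)%:R :> R.
Proof.
elim: m => [|m IH]; first by rewrite big_ord0.
rewrite big_mkcond big_ord_recr -big_mkcond /= {}IH; case: ltnP => im; last first.
  have -> : (m - i = 0)%N by lia.
  have -> : (m.-1 - i = 0)%N by lia.
  by rewrite mulr1.
have -> : (m - i = (m.-1 - i).+1)%N by lia.
rewrite factS natrM mulrC; congr (_ * _).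
by rewrite -natrB; [congr _%:R|]; lia.
Qed.

(** Induction on the number of boxes: by [frob_incr], removing a corner box turns the branching rule
    into the sum evaluated by [down_identity]. *)
Lemma dim_frob m l : is_partition l -> (size l <= m)%N ->
  (dimY l)%:R = ((sumn l)`!)%:R * frob m l.
Proof.
move: {2}(sumn l) (erefl (sumn l)) => n; elim: n l => [|n IH] l sl pl lm.
  rewrite (sumn0_partition pl sl) dimY_nil /frob /vdm /= mul1r -prodf_div big1 // => i _.
  rewrite nth_nil add0n -prod_shift.
  rewrite (eq_bigr (fun j : 'I_m => (j%:R - i%:R : R))).
    by rewrite prod_shift divff // pnatr_eq0 -lt0n fact_gt0.
  by move=> j _; rewrite /rcont !nth_nil; ring.
pose x i : R := rcont l i + (m%:R - 1).
have ix i : (i < m)%N -> i%:R + 1 <= m%:R :> R by rewrite natr1 ler_nat.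
have xE i : x i = (nth 0%N l i)%:R + (m%:R - 1 - i%:R) by rewrite /x /rcont; ring.
have dx : distinct x m.
  by move=> i j im jm /addIr; apply: rcont_distinct im jm.
have x0 i : (i < m)%N -> 0 <= x i.
  by move=> /ix im; rewrite xE; have := ler0n R (nth 0%N l i); lra.
rewrite (@dimY_rec l m) ?sl // natr_sum.
transitivity (\sum_(i < m) (n`!)%:R * frob m l * (x i *
   (\prod_(j < m | j != i :> nat) (x i - 1 - x j)) / nodal x m i)).
  rewrite big_mkcond; apply: eq_bigr => i _; case: ifP => ci.
    have pd := decr_partition pl ci.
    rewrite IH ?sumn_decr ?sl ?(leq_trans (size_decr ci)) //.
    have := frob_incr (ltn_ord i) pd; rewrite incr_decr //.
    have e j : j != i :> nat -> rcont (decr l i) j = rcont l j.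
      by move=> ji; rewrite /rcont nth_decr // eq_sym (negbTE ji) subn0.
    have ei : rcont (decr l i) i = rcont l i - 1.
      rewrite /rcont nth_decr // eqxx /= natrB; last by move: ci; rewrite /corner; lia.
      by ring.
    have -> : nodal (rcont (decr l i)) m i = \prod_(j < m | j != i :> nat) (x i - 1 - x j).
      by apply: eq_bigr => j ji; rewrite ei e // /x; ring.
    have -> : \prod_(j < m | j != i :> nat) (rcont (decr l i) i + 1 - rcont (decr l i) j) = nodal x m i.
      by apply: eq_bigr => j ji; rewrite ei e // /x; ring.
    have -> : rcont (decr l i) i + m%:R = x i by rewrite ei /x; ring.
    have N0 : nodal x m i != 0 by apply: nodal_neq0.
    move=> E; apply: (mulIf N0).
    by rewrite -[LHS]mulrA -E; field.
  (* A row that is not a corner contributes 0: either the next row has the same length and the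
     factor [x i - 1 - x i.+1] vanishes, or [i] is the last index, the row is empty and
     [x i = 0]. *)
  rewrite [X in _ * (X / _)](_ : _ = 0) ?mul0r ?mulr0 //.
  have /sorted_nth /(_ i) h := partition_sorted pl.
  have {h} h : nth 0%N l i.+1 = nth 0%N l i by move: ci h; rewrite /corner; lia.
  case: (ltnP i.+1 m) => im.
    rewrite (bigD1 (Ordinal im)) /= ?gtn_eqF // !xE h -natr1.
    by rewrite [X in _ * (X * _)](_ : _ = 0) ?mul0r ?mulr0 //; ring.
  have im' : m = i.+1 by apply/eqP; rewrite eqn_leq im ltn_ord.
  rewrite xE -h nth_default; last by rewrite -im'.
  have -> : m%:R = i%:R + 1 :> R by rewrite natr1 {1}im'.
  by rewrite [X in X * _](_ : _ = 0) ?mul0r //; ring.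
rewrite -mulr_sumr down_identity //.
have -> : \sum_(i < m) x i - m%:R * (m%:R - 1) / 2 = (sumn l)%:R.
  have -> : \sum_(i < m) x i = (\sum_(i < m) nth 0%N l i)%:R + m%:R * (m%:R - 1) - \sum_(i < m) i%:R.
    have -> : m%:R * (m%:R - 1) = \sum_(i < m) (m%:R - 1) :> R by rewrite sumr_const card_ord mulr_natl.
    by rewrite natr_sum -big_split /= -sumrB; apply: eq_bigr => i _; rewrite xE; ring.
  have -> : (\sum_(i < m) nth 0 l i)%N = sumn l.
    rewrite sumnE (big_nth 0%N) big_mkord [RHS](big_ord_widen m (fun i => nth 0%N l i)) //.
    by rewrite [RHS]big_mkcond; apply: eq_bigr => i _; case: ltnP => // h; rewrite nth_default.
  by rewrite sum_nat_ord; field.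
by rewrite sl factS natrM; ring.
Qed.

End Frobenius.

(** * Moments of the transition probabilities *)

Section Transition.
Variable R : realFieldType.
Implicit Types (l : seq nat) (n m k i : nat).
Local Notation rcont := (rcont R).

(* Kerov's transition probability from [l] to [incr_nth l i]; it vanishes when
   [i] is not an addable row. *)
Definition trans_wt l n i : R :=
  \prod_(j < n) (rcont l i - (rcont l j - 1)) / nodal (rcont l) n.+1 i.

Lemma rcont_default l n : (size l <= n)%N -> rcont l n = - n%:R.
Proof. by move=> h; rewrite /rcont nth_default // sub0r. Qed.

(** The quotient of the Frobenius formulas for the two diagrams, both taken with [n + 1] rows. *)
Lemma dim_transition l n i : is_partition l -> (size l <= n)%N -> (i < n.+1)%N ->
  (if addable l i then (dimY (incr_nth l i))%:R else 0) =
  (sumn l).+1%:R * (dimY l)%:R * trans_wt l n i.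
Proof.
move=> pl ln im; case: ifP => ai; last first.
  (* Row [i] is as long as the row above it, so the numerator factor of that row is 0. *)
  rewrite /trans_wt; case: i im ai => // i im; rewrite /addable /= => ai.
  have /sorted_nth /(_ i) h := partition_sorted pl.
  have e : nth 0%N l i.+1 = nth 0%N l i by lia.
  rewrite (bigD1 (Ordinal (im : (i < n)%N))) //= /rcont e -natr1.
  by rewrite [X in X * _ / _](_ : _ = 0) ?mul0r ?mulr0 //; ring.
have pi := incr_partition pl ai.
have si : (size (incr_nth l i) <= n.+1)%N.
  by rewrite size_incr_nth; case: ifP => // _; apply: leq_trans ln _.
rewrite (dim_frob R pi si) (dim_frob R pl (leq_trans ln (leqnSn _))) sumn_incr.
have := @frob_incr R n.+1 l i im pl.
(* The factor [j = i] is 1. Row [n] is empty with [rcont l n = - n], so its factor equals the one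
   that [frob_incr] takes from the factorial, and they cancel. *)
have -> : \prod_(j < n.+1 | j != i :> nat) (rcont l i + 1 - rcont l j) =
    \prod_(j < n) (rcont l i - (rcont l j - 1)) * (rcont l i + n.+1%:R).
  transitivity (\prod_(j < n.+1) (rcont l i + 1 - rcont l j)).
    by rewrite [RHS](bigD1 (Ordinal im)) //= [X in X * _](_ : _ = 1) ?mul1r //; ring.
  rewrite big_ord_recr /= (rcont_default ln) -natr1; congr (_ * _); last by ring.
  by apply: eq_bigr => j _; ring.
rewrite factS natrM /trans_wt.
have N0 : nodal (rcont l) n.+1 i != 0 by apply: nodal_neq0 => //; apply: rcont_distinct.
have s0 : rcont l i + n.+1%:R != 0.
  have := ler0n R (nth 0%N l i); have : i%:R < n.+1%:R :> R by rewrite ltr_nat.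
  by rewrite /rcont => h1 h2; rewrite gt_eqF //; lra.
move: (\prod_(j < n) _) => A E.
have {}E : frob R n.+1 (incr_nth l i) * nodal (rcont l) n.+1 i = frob R n.+1 l * A.
  by apply: (mulIf s0); rewrite mulrAC E; ring.
apply: (mulIf N0); rewrite -[LHS]mulrA E; field.
by [].
Qed.

(** Since [l] has at most [sumn l] rows, the [sumn l + 1] nodes include every addable row. *)
Definition moment l k : R := superh (rcont l) (fun j => rcont l j - 1) (sumn l) k.

Lemma momentE l k : moment l k =
  \sum_(i < (sumn l).+1) trans_wt l (sumn l) i * rcont l i ^+ k.
Proof. by apply: eq_bigr => i _; rewrite -mulrA mulrC. Qed.

Definition csum (f : R -> R) l : R := \sum_(c <- contents l) f c%:~R.

Lemma csumE f l n : (size l <= n)%N ->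
  csum f l = \sum_(i < n) \sum_(j < nth 0%N l i) f (j%:R - i%:R).
Proof.
move=> ln; rewrite /csum /contents big_flatten big_map.
rewrite -{1}[size l]subn0 -/(index_iota _ _) big_mkord.
rewrite (big_ord_widen n (fun i => \sum_(c <- [seq (j%:Z - i%:Z) | j <- iota 0 (nth 0%N l i)]) f c%:~R)) //.
rewrite big_mkcond; apply: eq_bigr => i _.
have -> : \sum_(c <- [seq (j%:Z - i%:Z) | j <- iota 0 (nth 0%N l i)]) f c%:~R =
    \sum_(j < nth 0%N l i) f (j%:R - i%:R).
  rewrite big_map -{1}[nth _ _ _]subn0 -/(index_iota _ _) big_mkord.
  by apply: eq_bigr => j _; rewrite intrB.
by case: ltnP => // h; rewrite nth_default // big_ord0.
Qed.

Lemma csum_incr f l i : is_partition l -> addable l i ->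
  csum f (incr_nth l i) = csum f l + f (rcont l i).
Proof.
move=> pl ai; have si := addable_size ai.
have im : (i < (size l).+1)%N by [].
have s1 : (size (incr_nth l i) <= (size l).+1)%N by rewrite size_incr_nth; case: ifP.
rewrite (csumE _ s1) (csumE _ (leqnSn _)) [LHS](bigD1 (Ordinal im)) //= [X in _ = X + _](bigD1 (Ordinal im)) //= nth_incr_nth eqxx add1n.
rewrite big_ord_recr /= -!addrA; congr (_ + _); rewrite addrC; congr (_ + _).
by apply: eq_bigr => j ji; rewrite nth_incr_nth eq_sym (negbTE (ji : (j : nat) != i)).
Qed.

Lemma telescope_ord (g : nat -> R) n : \sum_(j < n) (g j.+1 - g j) = g n - g 0%N.
Proof. by rewrite -(big_mkord xpredT (fun j => g j.+1 - g j)) telescope_sumr. Qed.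

Lemma psum_diff_csum l n k : (size l <= n)%N ->
  psum_diff (rcont l) (fun j => rcont l j - 1) n k =
  0 ^+ k + csum (fun c => (c + 1) ^+ k + (c - 1) ^+ k - 2 * c ^+ k) l.
Proof.
move=> ln; rewrite (csumE _ ln) /psum_diff big_ord_recr /= addrAC -sumrB.
pose g (z : R) := z ^+ k - (z - 1) ^+ k.
(* Along row [i] the second differences at the contents telescope to [g] at the two ends of the
   row. *)
rewrite [X in _ = _ + X](eq_bigr (fun i : 'I_n => g (rcont l i) - g (- i%:R))); last first.
  move=> i _; have := telescope_ord (fun j => g (j%:R - i%:R)) (nth 0%N l i).
  rewrite sub0r -/(rcont l i) => <-.
  apply: eq_bigr => j _.
  rewrite /g -[j.+1%:R]natr1; have -> : j%:R + 1 - i%:R - 1 = j%:R - i%:R :> R by ring.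
  have -> : j%:R + 1 - i%:R = j%:R - i%:R + 1 :> R by ring.
  by ring.
rewrite [in RHS]sumrB /g (rcont_default ln).
(* The row starts [- i] telescope down the first column; the end [- n] cancels the extra node and
   leaves [0 ^+ k]. *)
have := telescope_ord (fun i => (- i%:R : R) ^+ k) n; rewrite /= oppr0 => T.
have -> : \sum_(i < n) ((- i%:R) ^+ k - (- i%:R - 1) ^+ k) = 0 ^+ k - (- n%:R) ^+ k :> R.
  rewrite -opprB -T -sumrN; apply: eq_bigr => i _.
  by rewrite opprB -[i.+1%:R]natr1 opprD.
by ring.
Qed.

(** A second difference lowers the degree by two. This is what matches degree [j + 2] for the [j]-th
    power sum. *)
Lemma second_diff_expand k (c : R) : (c + 1) ^+ k + (c - 1) ^+ k - 2 * c ^+ k =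
  \sum_(i < k.-1) ('C(k, i))%:R * (1 + (-1) ^+ (k - i)) * c ^+ i.
Proof.
case: k => [|k] /=; first by rewrite big_ord0 !expr0; ring.
have -> : (c + 1) ^+ k.+1 + (c - 1) ^+ k.+1 =
    \sum_(i < k.+2) ('C(k.+1, i))%:R * (1 + (-1) ^+ (k.+1 - i)) * c ^+ i.
  rewrite ![c + _]addrC !exprDn -big_split /=; apply: eq_bigr => i _.
  by rewrite expr1n -[X in X + _]mulr_natr -[X in _ + X = _]mulr_natr; ring.
rewrite !big_ord_recr /= !binn subSnn subnn.
by ring.
Qed.

End Transition.

(** * The degree filtration and Plancherel averages *)

Section Filtration.
Variable R : realFieldType.
Implicit Types (l : seq nat) (F G : seq nat -> R) (Psi : seq nat -> R -> R).
Local Notation rcont := (rcont R).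

(* The algebra generated by the power sums of contents, filtered by giving the
   [j]-th power sum (with the number of boxes for [j = 0]) degree [j + 2]. *)
Inductive degle : nat -> (seq nat -> R) -> Prop :=
| degle_const d a : degle d (fun=> a)
| degle_psum j : degle j.+2 (csum (fun c => c ^+ j))
| degle_add d F G : degle d F -> degle d G -> degle d (fun l => F l + G l)
| degle_mul d e F G : degle d F -> degle e G -> degle (d + e) (fun l => F l * G l)
| degle_weaken d e F : (d <= e)%N -> degle d F -> degle e F
| degle_ext d F G : (forall l, is_partition l -> F l = G l) -> degle d F -> degle d G.

Lemma degle_sum d (n : nat) (F : nat -> seq nat -> R) :
  (forall i, (i < n)%N -> degle d (F i)) -> degle d (fun l => \sum_(i < n) F i l).
Proof.
elim: n => [|n IH] H.
  by apply: (@degle_ext _ (fun=> 0)) (degle_const _ _) => l _; rewrite big_ord0.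
apply: (@degle_ext _ (fun l => \sum_(i < n) F i l + F n l)).
  by move=> l _; rewrite big_ord_recr.
by apply: degle_add; [apply: IH => i /leqW; apply: H | apply: H].
Qed.

Lemma degle_scale d a F : degle d F -> degle d (fun l => a * F l).
Proof. by move=> dF; rewrite -[d]add0n; apply: degle_mul => //; apply: degle_const. Qed.

Lemma degle_psum_diff k :
  degle k (fun l => psum_diff (rcont l) (fun j => rcont l j - 1) (sumn l) k).
Proof.
apply: (@degle_ext _ (fun l => 0 ^+ k + \sum_(i < k.-1)
    ('C(k, i))%:R * (1 + (-1) ^+ (k - i)) * csum (fun c => c ^+ i) l)).
  move=> l pl; rewrite psum_diff_csum ?partition_size_le //; congr (_ + _).
  rewrite /csum; under [RHS]eq_bigr do rewrite second_diff_expand.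
  by rewrite exchange_big; apply: eq_bigr => i _; rewrite mulr_sumr.
apply: degle_add; first exact: degle_const.
apply: (degle_sum (F := fun i l => ('C(k, i))%:R * (1 + (-1) ^+ (k - i)) * csum (fun c => c ^+ i) l)) => i ik.
by apply/degle_scale/(@degle_weaken i.+2); [lia | apply: degle_psum].
Qed.

(** Newton's identity divided by [k]: the degrees [j + 1] and [k - j - 1] of each product add up to
    [k]. *)
Lemma degle_moment k : degle k ((moment R)^~ k).
Proof.
elim/ltn_ind: k => -[_|k IH].
  apply: (@degle_ext _ (fun=> 1)) (degle_const _ _) => l pl.
  by rewrite /moment superh0 //; apply: rcont_distinct.
apply: (@degle_ext _ (fun l => k.+1%:R^-1 * \sum_(j < k.+1)
    psum_diff (rcont l) (fun j => rcont l j - 1) (sumn l) j.+1 * moment R l (k.+1 - j.+1))).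
  move=> l pl; rewrite -superh_newton; last exact: rcont_distinct.
  by rewrite mulKf // pnatr_eq0.
apply: degle_scale.
apply: (degle_sum (F := fun j l => psum_diff (rcont l) (fun j => rcont l j - 1) (sumn l) j.+1 * moment R l (k.+1 - j.+1))) => j jk.
rewrite -{1}(subnKC jk); apply: degle_mul; first exact: degle_psum_diff.
by apply: IH; lia.
Qed.

(* The increments caused by adding a box of content [c]: every factor [c ^+ k]
   costs [k + 2] in the degree of its coefficient. *)
Inductive incrle : nat -> (seq nat -> R -> R) -> Prop :=
| incrle_0 d : incrle d (fun _ _ => 0)
| incrle_mono e k F : degle e F -> incrle (e + k.+2) (fun l c => F l * c ^+ k)
| incrle_add d Psi Psi' : incrle d Psi -> incrle d Psi' ->
    incrle d (fun l c => Psi l c + Psi' l c)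
| incrle_weaken d e Psi : (d <= e)%N -> incrle d Psi -> incrle e Psi
| incrle_ext d Psi Psi' : (forall l c, Psi l c = Psi' l c) -> incrle d Psi -> incrle d Psi'.

Lemma incrle_scale d e F Psi : degle d F -> incrle e Psi ->
  incrle (d + e) (fun l c => F l * Psi l c).
Proof.
move=> dF; elim=> {e Psi} [e|e k G dG|e Psi Psi' _ I _ I'|e e' Psi ee' _ I|e Psi Psi' E _ I].
- by apply: incrle_ext (incrle_0 _) => l c; rewrite mulr0.
- rewrite addnA; apply: incrle_ext (incrle_mono k (degle_mul dF dG)) => l c.
  by rewrite mulrA.
- by apply: incrle_ext (incrle_add I I') => l c; rewrite mulrDr.
- by apply: incrle_weaken I; rewrite leq_add2l.
- by apply: incrle_ext I => l c; rewrite E.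
Qed.

Lemma incrle_mul d e Psi Psi' : incrle d Psi -> incrle e Psi' ->
  incrle (d + e) (fun l c => Psi l c * Psi' l c).
Proof.
move=> H H'; elim: H => {d Psi} [d|d k F dF|d Psi Psi1 _ I _ I'|d d' Psi dd' _ I|d Psi Psi1 E _ I].
- by apply: incrle_ext (incrle_0 _) => l c; rewrite mul0r.
- elim: H' => {e Psi'} [e|e j G dG|e Psi Psi1 _ I _ I'|e e' Psi ee' _ I|e Psi Psi1 E _ I].
  + by apply: incrle_ext (incrle_0 _) => l c; rewrite mulr0.
  (* A product of two monomials pays the surcharge 2 only once, so its degree is below the required
     bound. *)
  + apply: (@incrle_weaken (d + e + (k + j).+2)); first lia.
    apply: incrle_ext (incrle_mono (k + j) (degle_mul dF dG)) => l c.
    by rewrite exprD; ring.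
  + by apply: incrle_ext (incrle_add I I') => l c; rewrite mulrDr.
  + by apply: incrle_weaken I; rewrite leq_add2l.
  + by apply: incrle_ext I => l c; rewrite E.
- by apply: incrle_ext (incrle_add I I') => l c; rewrite mulrDl.
- by apply: incrle_weaken I; rewrite leq_add2r.
- by apply: incrle_ext I => l c; rewrite E.
Qed.

Lemma degle_incr d F : degle d F -> exists2 Psi, incrle d Psi &
  forall l i, is_partition l -> addable l i -> F (incr_nth l i) = F l + Psi l (rcont l i).
Proof.
elim=> {d F} [d a|j|d F G _ [Psi I E] _ [Psi' I' E']|d e F G dF [Psi I E] dG [Psi' I' E']|d e F de _ [Psi I E]|d F G FG _ [Psi I E]].
- by exists (fun _ _ => 0); [apply: incrle_0 | move=> l i _ _; rewrite addr0].
- exists (fun _ c => 1 * c ^+ j); last by move=> l i pl ai; rewrite csum_incr // mul1r.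
  by apply: (incrle_mono j (degle_const 0 1)).
- exists (fun l c => Psi l c + Psi' l c); first exact: incrle_add.
  by move=> l i pl ai; rewrite E // E' // addrACA.
(* The discrete Leibniz rule. *)
- exists (fun l c => F l * Psi' l c + (G l * Psi l c + Psi l c * Psi' l c)).
    apply: incrle_add; first exact: incrle_scale.
    by apply: incrle_add; [rewrite addnC; apply: incrle_scale | apply: incrle_mul].
  by move=> l i pl ai; rewrite E // E' //; ring.
- by exists Psi => //; apply: incrle_weaken I.
- by exists Psi => // l i pl ai; rewrite -!FG ?E //; apply: incr_partition.
Qed.

End Filtration.

(** * Plancherel sums over lists of partitions *)

Section Partitions.
Implicit Types (l : seq nat) (n : nat).

Definition parts n : seq (seq nat) :=
  [seq tuple_to_part t | t : n.-tuple 'I_n.+1 in [pred t | is_Yn_tuple t]].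

Lemma tuple_to_partE n (t : n.-tuple 'I_n.+1) :
  tuple_to_part t = trim (map (@nat_of_ord n.+1) t).
Proof. by rewrite /trim filter_map. Qed.

Lemma mem_parts n l : (l \in parts n) = is_partition l && (sumn l == n).
Proof.
apply/imageP/andP => [[t /andP[st /eqP sut] ->]|[pl /eqP sl]].
  by rewrite tuple_to_partE trim_partition // sumn_trim sut.
have ln : (size l <= n)%N by rewrite -sl partition_size_le.
(* Padding with zeros inverts trimming; a partition of [n] has at most [n] parts. *)
pose s := l ++ nseq (n - size l) 0%N.
have szs : size s = n by rewrite size_cat size_nseq subnKC.
have nths i : nth 0%N s i = nth 0%N l i.
  by rewrite nth_cat; case: ltnP => // h; rewrite nth_nseq nth_default //; case: ifP.
have ss : sorted geq s.
  by apply/sorted_nth => i; rewrite !nths; have /sorted_nth := partition_sorted pl.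
have tr : trim s = l.
  apply: partition_ext => //; first exact: trim_partition.
  by move=> i; rewrite nth_trim.
have szo : size (map (@inord n) s) == n by rewrite size_map szs.
have mo : map (@nat_of_ord n.+1) (Tuple szo) = s.
  rewrite /= -map_comp -[RHS]map_id; apply/eq_in_map => x xs /=.
  rewrite inordK // ltnS; have := nth_index 0%N xs; rewrite nths => <-.
  by rewrite -sl partition_nth_le.
exists (Tuple szo); last by rewrite tuple_to_partE mo.
by rewrite inE /is_Yn_tuple mo ss -sumn_trim tr sl eqxx.
Qed.

Lemma parts_uniq n : uniq (parts n).
Proof.
apply/dinjectiveP => t t' /andP[st _] /andP[st' _] e.
apply/val_inj/(inj_map val_inj) => /=.
rewrite (sorted_trim st) (sorted_trim st') !size_map !size_tuple.
by move: e; rewrite !tuple_to_partE => ->.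
Qed.

Lemma reindex_corner (R : nmodType) n i (H : seq nat -> R) :
  \sum_(l <- parts n.+1 | corner l i) H (decr l i) =
  \sum_(l <- parts n | addable l i) H l.
Proof.
rewrite -[LHS]big_filter -[RHS]big_filter -(big_map (decr^~ i) xpredT H).
apply: perm_big; apply: uniq_perm.
- rewrite map_inj_in_uniq ?filter_uniq ?parts_uniq // => l l'.
  rewrite !mem_filter !mem_parts => /and3P[cl pl _] /and3P[cl' pl' _] e.
  by rewrite -(incr_decr pl cl) e incr_decr.
- by rewrite filter_uniq ?parts_uniq.
move=> l; rewrite mem_filter mem_parts; apply/mapP/and3P => [[l']|[al pl /eqP sl]].
  rewrite mem_filter mem_parts => /and3P[cl pl /eqP sl] ->.
  by rewrite addable_decr // decr_partition // sumn_decr // sl.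
exists (incr_nth l i); last by rewrite decr_incr.
by rewrite mem_filter mem_parts corner_incr // incr_partition // sumn_incr sl eqxx.
Qed.

Lemma planch_avgE (R : fieldType) (F : seq nat -> R) n :
  planch_avg F n = \sum_(l <- parts n) ((dimY l)%:R ^+ 2 / (n`!)%:R) * F l.
Proof. by rewrite /parts big_image. Qed.

End Partitions.

(** * Plancherel growth and polynomiality of averages *)

Section Averages.
Variable R : realFieldType.
Implicit Types (l : seq nat) (F G : seq nat -> R) (Psi : seq nat -> R -> R).
Local Notation rcont := (rcont R).

Lemma planch_avg_ext F G n : (forall l, is_partition l -> F l = G l) ->
  planch_avg F n = planch_avg G n.
Proof.
move=> E; rewrite !planch_avgE; apply: eq_big_seq => l.
by rewrite mem_parts => /andP[pl _]; rewrite E.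
Qed.

Lemma planch_avgD F G n :
  planch_avg (fun l => F l + G l) n = planch_avg F n + planch_avg G n.
Proof. by rewrite !planch_avgE -big_split; apply: eq_bigr => l _; rewrite mulrDr. Qed.

Definition trans_avg Psi l : R :=
  \sum_(i < (sumn l).+1) trans_wt R l (sumn l) i * Psi l (rcont l i).

(** Only one of the two factors [dimY l] is expanded by the branching rule. Summing over the smaller
    diagram instead, the other factor becomes a transition weight through [dim_transition]. *)
Lemma planch_avg_transition F n : planch_avg F n.+1 =
  planch_avg (fun l => \sum_(i < n.+1) trans_wt R l n i * F (incr_nth l i)) n.
Proof.
rewrite !planch_avgE.
transitivity (\sum_(l <- parts n.+1) \sum_(i < n.+1 | corner l i)
  (fun k => (dimY k)%:R * ((dimY (incr_nth k i))%:R / (n.+1`!)%:R * F (incr_nth k i))) (decr l i)).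
  apply: eq_big_seq => l; rewrite mem_parts => /andP[pl /eqP sl].
  have ln : (size l <= n.+1)%N by rewrite -sl partition_size_le.
  rewrite expr2 {1}(@dimY_rec l n.+1) ?sl //.
  rewrite natr_sum !mulr_suml; apply: eq_bigr => i ci.
  by rewrite incr_decr // !mulrA.
rewrite (exchange_big_dep xpredT) //=.
under eq_bigr => i _ do rewrite (reindex_corner n i (fun k => (dimY k)%:R * ((dimY (incr_nth k i))%:R / (n.+1`!)%:R * F (incr_nth k i)))).
under eq_bigr => i _ do rewrite big_mkcond.
rewrite exchange_big /=; apply: eq_big_seq => l; rewrite mem_parts => /andP[pl /eqP sl].
rewrite mulr_sumr; apply: eq_bigr => i _.
have ln : (size l <= n)%N by rewrite -sl partition_size_le.
have := dim_transition R pl ln (ltn_ord i).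
have f0 : (n`!)%:R != 0 :> R by rewrite pnatr_eq0 -lt0n fact_gt0.
have n0 : n.+1%:R != 0 :> R by rewrite pnatr_eq0.
have d0 : (dimY l)%:R != 0 :> R by rewrite pnatr_eq0 -lt0n dimY_gt0.
rewrite factS natrM sl; move: n.+1%:R n0 => a n0.
case: ifP => _ E; first by rewrite E; field; rewrite f0 n0.
have -> : trans_wt R l n i = 0.
  by apply: (mulfI (mulf_neq0 n0 d0)); rewrite -E mulr0.
by rewrite mul0r mulr0.
Qed.

Lemma trans_wt_sum l n : is_partition l -> (size l <= n)%N ->
  \sum_(i < n.+1) trans_wt R l n i = 1.
Proof.
move=> pl ln; rewrite -(@superh0 R (rcont l) (fun j => rcont l j - 1) n); last exact: rcont_distinct.
by apply: eq_bigr => i _; rewrite expr0 mul1r.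
Qed.

Lemma planch_avg_step F Psi n :
  (forall l i, is_partition l -> addable l i -> F (incr_nth l i) = F l + Psi l (rcont l i)) ->
  planch_avg F n.+1 = planch_avg F n + planch_avg (trans_avg Psi) n.
Proof.
move=> E; rewrite planch_avg_transition -planch_avgD !planch_avgE.
apply: eq_big_seq => l; rewrite mem_parts => /andP[pl /eqP sl]; congr (_ * _).
have ln : (size l <= n)%N by rewrite -sl partition_size_le.
(* The weights sum to 1, so [F l] spreads over all rows; rows that are not addable, about which [E]
   says nothing, have weight 0. *)
rewrite /trans_avg sl -[F l]mul1r -(trans_wt_sum pl ln) mulr_suml -big_split /=.
apply: eq_bigr => i _; rewrite -mulrDr.
have := dim_transition R pl ln (ltn_ord i); case: ifP => [ai _|_ E0]; first by rewrite E.
suff -> : trans_wt R l n i = 0 by rewrite !mul0r.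
apply/eqP; move/esym/eqP: E0; rewrite !mulf_eq0 !pnatr_eq0 /=.
by rewrite eqn0Ngt dimY_gt0.
Qed.

Definition poly_fun (u : nat -> R) := exists P : {poly R}, forall n, u n = P.[n%:R].

Lemma poly_funD u v : poly_fun u -> poly_fun v -> poly_fun (fun n => u n + v n).
Proof. by move=> [P HP] [Q HQ]; exists (P + Q) => n; rewrite hornerD HP HQ. Qed.

Lemma poly_fun_scale a u : poly_fun u -> poly_fun (fun n => a * u n).
Proof. by move=> [P HP]; exists (a *: P) => n; rewrite hornerZ HP. Qed.

Lemma poly_fun_sum (I : nat) (u : nat -> nat -> R) :
  (forall i, (i < I)%N -> poly_fun (u i)) -> poly_fun (fun n => \sum_(i < I) u i n).
Proof.
elim: I => [|I IH] H; first by exists 0 => n; rewrite big_ord0 horner0.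
have [||P HP] := @poly_funD (fun n => \sum_(i < I) u i n) (u I); [|exact: H|].
  by apply: IH => i /leqW; apply: H.
by exists P => n; rewrite big_ord_recr /= HP.
Qed.

Lemma poly_fun_eq u v : u =1 v -> poly_fun u -> poly_fun v.
Proof. by move=> e [P HP]; exists P => n; rewrite -e. Qed.

Definition partial_sum (u : nat -> R) n := \sum_(i < n) u i.

Lemma poly_fun_partial_sum u : poly_fun u -> poly_fun (partial_sum u).
Proof.
have mono k : poly_fun (partial_sum (fun n => n%:R ^+ k)).
  elim/ltn_ind: k => k IH.
  (* Summing this over [x = 0, ..., n - 1] telescopes and expresses the sum of [k]-th powers through
     those of lower powers. *)
  have key (x : R) : (x + 1) ^+ k.+1 =
      x ^+ k.+1 + k.+1%:R * x ^+ k + \sum_(i < k) ('C(k.+1, i))%:R * x ^+ i.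
    transitivity (\sum_(i < k.+2) ('C(k.+1, i))%:R * x ^+ i).
      by rewrite addrC exprDn; apply: eq_bigr => i _; rewrite expr1n mul1r mulr_natl.
    by rewrite !big_ord_recr /= binn binSn; ring.
  pose S i := partial_sum (fun n => n%:R ^+ i).
  apply: (@poly_fun_eq (fun n => k.+1%:R^-1 *
    (n%:R ^+ k.+1 + (-1) * \sum_(i < k) ('C(k.+1, i))%:R * S i n))); last first.
    apply/poly_fun_scale/poly_funD; first by exists 'X^(k.+1) => n; rewrite hornerXn.
    apply/poly_fun_scale/(@poly_fun_sum k (fun i n => ('C(k.+1, i))%:R * S i n)) => i ik.
    by apply/poly_fun_scale/IH.
  move=> n; rewrite /S /partial_sum; elim: n => [|n IHn].
    rewrite big_ord0 expr0n /= big1 ?mulr0 ?addr0 ?mulr0 // => i _.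
    by rewrite big_ord0 mulr0.
  rewrite [RHS]big_ord_recr -{}IHn /=.
  under eq_bigr => i _ do rewrite big_ord_recr /= mulrDr.
  rewrite big_split /= -[n.+1%:R]natr1 key.
  have : k.+1%:R != 0 :> R by rewrite pnatr_eq0.
  by move: (k.+1%:R) => a a0; field.
move=> [P HP]; apply: (@poly_fun_eq (fun n => \sum_(i < size P) P`_i * partial_sum (fun n => n%:R ^+ i) n)).
  move=> n; rewrite /partial_sum; under [RHS]eq_bigr do rewrite HP horner_coef.
  by rewrite exchange_big; apply: eq_bigr => i _; rewrite mulr_sumr.
by apply: (@poly_fun_sum _ (fun i n => P`_i * partial_sum (fun n => n%:R ^+ i) n)) => i _; apply: poly_fun_scale.
Qed.

Lemma planch_avg_poly d F : degle d F -> poly_fun (planch_avg F).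
Proof.
elim/ltn_ind: d F => d IH F /degle_incr[Psi I E].
have H : poly_fun (planch_avg (trans_avg Psi)).
  (* The outer hypothesis is carried through this induction because weakening changes the degree
     bound. *)
  elim: I IH {E} => {d Psi} [d|e k G dG|d Psi Psi' _ I _ I'|d e Psi de _ I|d Psi Psi' E _ I] IH.
  - exists 0 => n; rewrite horner0 planch_avgE big1 // => l _.
    by rewrite /trans_avg big1 ?mulr0 // => i _; rewrite mulr0.
  (* Averaging [c ^+ k] over the added box gives a moment, of degree [k] instead of the charged
     [k + 2]: here the degree drops. *)
  - apply: (@poly_fun_eq (planch_avg (fun l => G l * moment R l k))).
      move=> n; apply: planch_avg_ext => l pl.
      by rewrite momentE mulr_sumr; apply: eq_bigr => i _; rewrite mulrCA.
    by apply: (IH (e + k)%N); [lia | apply: degle_mul dG (degle_moment _ _)].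
  - apply: poly_fun_eq (poly_funD (I IH) (I' IH)) => n.
    rewrite -planch_avgD; apply: planch_avg_ext => l pl.
    by rewrite /trans_avg -big_split; apply: eq_bigr => i _; rewrite mulrDr.
  - by apply: I => d' dd'; apply: IH; apply: leq_trans de.
  - apply: poly_fun_eq (I IH) => n; apply: planch_avg_ext => l pl.
    by apply: eq_bigr => i _; rewrite E.
have [P HP] := poly_fun_partial_sum H.
exists ((planch_avg F 0)%:P + P) => n; rewrite hornerD hornerC -HP.
elim: n => [|n IHn]; first by rewrite /partial_sum big_ord0 addr0.
by rewrite (planch_avg_step n E) IHn /partial_sum big_ord_recr addrA.
Qed.

End Averages.

(** * Monomial symmetric functions as polynomials in power sums *)

Section AugmentedMonomials.
Variable R : realFieldType.
Implicit Types (xs : seq R) (ks mu w : seq nat).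

Fixpoint inj_words (N l : nat) : seq (seq nat) :=
  if l is l'.+1 then
    [seq i :: w | w <- inj_words N l', i <- [seq i <- iota 0 N | i \notin w]]
  else [:: [::]].

Lemma mem_inj_words N l w :
  (w \in inj_words N l) = [&& size w == l, uniq w & all (fun i => i < N)%N w].
Proof.
elim: l w => [|l IH] w; first by rewrite inE; case: w.
apply/allpairsPdep/idP => [[w' [i [+ + ->]]]|].
  by rewrite mem_filter mem_iota IH /= add0n eqSS => /and3P[-> -> ->] /andP[-> ->].
case: w => //= i w; rewrite eqSS => /and3P[sw /andP[iw uw] /andP[iN aw]].
by exists w, i; rewrite IH mem_filter mem_iota iw sw uw aw.
Qed.

Lemma inj_words_uniq N l : uniq (inj_words N l).
Proof.
elim: l => //= l IH; apply: allpairs_uniq_dep => //.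
  by move=> w _; rewrite filter_uniq ?iota_uniq.
by move=> [w i] [w' i'] _ _ /= [-> ->].
Qed.

Definition word_mono xs ks w : R :=
  \prod_(s < size ks) nth 0 xs (nth 0%N w s) ^+ nth 0%N ks s.

(* The monomial symmetric function of [ks] multiplied by the order of the
   stabiliser of [ks]; unlike [mono_eval] it does not need [ks] sorted. *)
Definition aug_mono ks xs : R :=
  \sum_(w <- inj_words (size xs) (size ks)) word_mono xs ks w.

(** In the product with the power sum, the new letter is either distinct from all letters of the
    word, or equals the [s]-th one, whose exponent then grows by [j]. *)
Lemma aug_mono_cons j ks xs : aug_mono (j :: ks) xs =
  (\sum_(x <- xs) x ^+ j) * aug_mono ks xs
  - \sum_(s < size ks) aug_mono (set_nth 0%N ks s (nth 0%N ks s + j)) xs.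
Proof.
rewrite /aug_mono mulr_sumr.
have sz (s : 'I_(size ks)) : size (set_nth 0%N ks s (nth 0%N ks s + j)) = size ks.
  by rewrite size_set_nth; apply/maxn_idPr.
under [X in _ = _ - X]eq_bigr => s _ do rewrite sz.
rewrite exchange_big -sumrB /= big_allpairs_dep.
apply: eq_big_seq => w; rewrite mem_inj_words => /and3P[/eqP sw uw aw].
under eq_bigr => i _ do rewrite /word_mono /= big_ord_recl /=.
rewrite -mulr_suml -/(word_mono xs ks w) big_filter.
have -> : \sum_(s < size ks) word_mono xs (set_nth 0%N ks s (nth 0%N ks s + j)) w =
    (\sum_(i <- w) nth 0 xs i ^+ j) * word_mono xs ks w.
  rewrite (big_nth 0%N) big_mkord sw mulr_suml; apply: eq_bigr => s _.
  rewrite /word_mono sz (bigD1 s) //= [in RHS](bigD1 s) //= nth_set_nth /= eqxx exprD [RHS]mulrA.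
  congr (_ * _); first by rewrite mulrC.
  by apply: eq_bigr => r rs; rewrite nth_set_nth /= ifN.
rewrite -mulrBl; congr (_ * _).
have -> : iota 0 (size xs) = index_iota 0 (size xs) by rewrite /index_iota subn0.
rewrite [X in _ = X - _](big_nth 0) [X in _ = X - _](bigID (fun i => i \in w)) /=.
rewrite -[X in _ = X + _ - _]big_filter [X in _ = X + _ - _](perm_big w); first by rewrite addrAC subrr add0r.
apply: uniq_perm => //; first by rewrite filter_uniq ?iota_uniq.
move=> i; rewrite mem_filter mem_index_iota; apply/andP/idP => [[]//|iw].
by rewrite iw (allP aw).
Qed.

Definition content_poly (F : seq nat -> R) := exists d, degle d F.

Lemma content_polyD F G : content_poly F -> content_poly G -> content_poly (fun l => F l + G l).
Proof.
move=> [d dF] [e dG]; exists (d + e)%N; apply: degle_add.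
  by apply: degle_weaken dF; apply: leq_addr.
by apply: degle_weaken dG; apply: leq_addl.
Qed.

Lemma content_poly_scale a F : content_poly F -> content_poly (fun l => a * F l).
Proof. by case=> d /(degle_scale a); exists d. Qed.

Lemma content_poly_ext F G : (forall l, is_partition l -> F l = G l) ->
  content_poly F -> content_poly G.
Proof. by move=> E [d dF]; exists d; apply: degle_ext dF. Qed.

Lemma content_poly_sum (I : Type) (r : seq I) (F : I -> seq nat -> R) :
  (forall i, content_poly (F i)) -> content_poly (fun l => \sum_(i <- r) F i l).
Proof.
move=> H; elim: r => [|i r IH].
  exists 0%N; apply: (@degle_ext _ _ (fun=> 0)) (degle_const _ _) => l _.
  by rewrite big_nil.
apply: content_poly_ext (content_polyD (H i) IH) => l _.
by rewrite big_cons.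
Qed.

Definition content_alphabet (l : seq nat) : seq R := [seq c%:~R | c <- contents l].

(** Induction on the number of parts: every term of [aug_mono_cons] involves one part fewer. *)
Lemma aug_mono_content_poly ks :
  content_poly (fun l => aug_mono ks (content_alphabet l)).
Proof.
move: {2}(size ks) (erefl (size ks)) => n; elim: n ks => [|n IH] [|j ks] //= sk.
  exists 0%N; apply: (@degle_ext _ _ (fun=> 1)) (degle_const _ _) => l _.
  by rewrite /aug_mono big_seq1 /word_mono big_ord0.
case: sk => sk.
apply: (@content_poly_ext (fun l => csum (fun c => c ^+ j) l * aug_mono ks (content_alphabet l)
  + (-1) * \sum_(s < size ks) aug_mono (set_nth 0%N ks s (nth 0%N ks s + j)) (content_alphabet l))).
  by move=> l _; rewrite aug_mono_cons mulN1r /csum big_map.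
apply: content_polyD.
  have [d dk] := IH _ sk; exists (j.+2 + d)%N.
  by apply: degle_mul => //; apply: degle_psum.
apply: content_poly_scale; apply: content_poly_sum => s; apply: IH.
by rewrite size_set_nth -sk; apply/maxn_idPr.
Qed.

(** The product of the factorials of the multiplicities in [mu], counted as permutations of
    positions. *)
Definition stab_size mu := count (fun v => map (nth 0%N mu) v == mu) (permutations (iota 0 (size mu))).

Lemma stab_size_gt0 mu : (0 < stab_size mu)%N.
Proof.
rewrite -has_count; apply/hasP; exists (iota 0 (size mu)); first by rewrite mem_permutations.
by rewrite map_nth_iota0 ?take_size.
Qed.

(** One ordering [s0] of [s] reads [mu]; the others arise from it by permuting positions within the
    stabiliser of [mu]. *)
Lemma count_arrangements (e : nat -> nat) mu (s : seq nat) : uniq s -> sort geq (map e s) = mu ->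
  count (fun w => map e w == mu) (permutations s) = stab_size mu.
Proof.
move=> us es; pose s0 := sort (relpre e geq) s.
have ps0 : perm_eq s0 s by rewrite perm_sort.
have us0 : uniq s0 by rewrite (perm_uniq ps0).
have es0 : map e s0 = mu by rewrite -es sort_map.
have sz : size s0 = size mu by rewrite -es0 size_map.
have idx : map (index^~ s0) s0 = iota 0 (size mu).
  apply: (@eq_from_nth _ 0%N); rewrite size_map ?size_iota // => i i0.
  by rewrite (nth_map 0%N) // index_uniq // nth_iota // -sz.
have nthi : map (nth 0%N s0) (iota 0 (size mu)) = s0 by rewrite -sz map_nth_iota0 ?take_size.
have emu i : (i < size mu)%N -> e (nth 0%N s0 i) = nth 0%N mu i.
  by move=> h; rewrite -es0 (nth_map 0%N) // sz.
rewrite /stab_size -!size_filter.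
rewrite -(size_map (map (nth 0%N s0)) [seq v <- permutations (iota 0 (size mu)) | _]).
apply/perm_size/uniq_perm.
- by rewrite filter_uniq ?permutations_uniq.
- rewrite map_inj_in_uniq ?filter_uniq ?permutations_uniq // => v v'.
  rewrite !mem_filter !mem_permutations => /andP[_ pv] /andP[_ pv'].
  have K u : perm_eq u (iota 0 (size mu)) -> map (index^~ s0) (map (nth 0%N s0) u) = u.
    move=> pu; rewrite -map_comp -[RHS]map_id; apply/eq_in_map => i.
    by rewrite (perm_mem pu) mem_iota /= => h; rewrite index_uniq // sz.
  by move=> /(congr1 (map (index^~ s0))); rewrite !K.
move=> w; rewrite mem_filter mem_permutations; apply/andP/mapP => [[/eqP ew pw]|[v + ->]].
  have pw0 : perm_eq w s0 by rewrite (perm_trans pw) // perm_sym.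
  have ws : map (nth 0%N s0) (map (index^~ s0) w) = w.
    rewrite -map_comp -[RHS]map_id; apply/eq_in_map => i iw /=.
    by rewrite nth_index // -(perm_mem pw0).
  exists (map (index^~ s0) w) => //.
  rewrite mem_filter mem_permutations -idx perm_map // andbT.
  rewrite -[X in _ == X]ew -[in X in _ == X]ws; apply/eqP.
  rewrite -!map_comp; apply/eq_in_map => i iw /=.
  by rewrite emu // -sz index_mem -(perm_mem pw0).
rewrite mem_filter mem_permutations => /andP[/eqP ev pv]; split.
  apply/eqP; rewrite -[RHS]ev -map_comp; apply/eq_in_map => i.
  by rewrite (perm_mem pv) mem_iota /= => h; rewrite emu.
by rewrite -(permPr ps0) -[X in perm_eq _ X]nthi perm_map.
Qed.

(** Group the words by their exponent vector: each vector of type [mu] comes from [stab_size mu]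
    words, any other from none. *)
Lemma aug_mono_eval mu xs : is_partition mu ->
  aug_mono mu xs = (stab_size mu)%:R * mono_eval mu xs.
Proof.
move=> pmu; set N := size xs; have smu := partition_sorted pmu.
(* A variable absent from [w] has [index] equal to the length, where [nth] returns the default
   exponent 0. *)
pose a w : {ffun 'I_N -> 'I_(sumn mu).+1} := [ffun i : 'I_N => inord (nth 0%N mu (index (i : nat) w))].
have aE w (i : 'I_N) : a w i = nth 0%N mu (index (i : nat) w) :> nat.
  by rewrite ffunE inordK // ltnS partition_nth_le.
have monoE w : w \in inj_words N (size mu) -> word_mono xs mu w = \prod_(i < N) nth 0 xs i ^+ a w i.
  rewrite mem_inj_words => /and3P[/eqP sw uw aw].
  under [RHS]eq_bigr do rewrite aE.
  rewrite -(big_mkord xpredT (fun i => nth 0 xs i ^+ nth 0%N mu (index i w))).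
  rewrite (bigID (fun i => i \in w)) /= [X in _ = _ * X]big1 ?mulr1; last first.
    by move=> i iw; rewrite (memNindex iw) sw [nth 0%N _ _]nth_default ?expr0.
  rewrite -big_filter (perm_big w) /=; last first.
    apply: uniq_perm => //; first by rewrite filter_uniq ?iota_uniq.
    move=> i; rewrite mem_filter mem_index_iota; apply/andP/idP => [[]//|iw].
    by rewrite iw (allP aw).
  rewrite (big_nth 0%N) big_mkord sw; apply: eq_bigr => i _.
  by rewrite index_uniq // sw.
rewrite /aug_mono (eq_big_seq _ monoE) (partition_big a xpredT) //= /mono_eval mulr_sumr.
rewrite [RHS]big_mkcond; apply: eq_bigr => b _.
rewrite (eq_bigr (fun=> \prod_(i < N) nth 0 xs i ^+ b i)); last by move=> w /eqP ->.
rewrite big_const_seq iter_addr_0.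
pose e i := nth 0%N [seq nat_of_ord (b k) | k <- enum 'I_N] i.
have eE (i : 'I_N) : e i = b i.
  by rewrite /e (nth_map i) ?size_enum_ord // nth_ord_enum.
pose s := [seq i <- iota 0 N | (0 < e i)%N].
have us : uniq s by rewrite filter_uniq ?iota_uniq.
have -> : [seq nat_of_ord (b i) | i <- enum 'I_N & (0 < b i)%N] = map e s.
  rewrite /s -val_enum_ord filter_map -map_comp.
  rewrite (eq_filter (a2 := preim val (fun i => (0 < e i)%N))); last by move=> i /=; rewrite eE.
  by apply: eq_map => i /=; rewrite eE.
(* The words over [b] are the orderings of its support [s] along which the exponents read [mu]. *)
have awb w : (w \in inj_words N (size mu)) && (a w == b) = perm_eq w s && (map e w == mu).
  apply/andP/andP => [[+ /eqP ab]|[pw /eqP ew]].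
    rewrite mem_inj_words => /and3P[/eqP sw uw aw].
    have eN i : (i < N)%N -> e i = nth 0%N mu (index i w).
      by move=> iN; rewrite (eE (Ordinal iN)) -ab aE.
    split.
      apply: uniq_perm => // i; rewrite mem_filter mem_iota add0n /=.
      case: (ltnP i N) => iN; last by rewrite andbF; apply/negP => /(allP aw); rewrite ltnNge iN.
      by rewrite eN // partition_nth_gt0 // -sw index_mem andbT.
    apply/eqP/(@eq_from_nth _ 0%N); rewrite size_map // => i iw.
    rewrite (nth_map 0%N) // eN ?index_uniq //.
    by apply: (allP aw); rewrite mem_nth.
  have sw : size w = size mu by rewrite -ew size_map.
  split.
    rewrite mem_inj_words sw eqxx (perm_uniq pw) us; apply/allP => i.
    by rewrite (perm_mem pw) mem_filter mem_iota => /andP[_].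
  apply/eqP/ffunP => i; apply: val_inj; rewrite /= aE -eE.
  case iw : (nat_of_ord i \in w).
    by rewrite -ew (nth_map 0%N) ?index_mem // nth_index.
  rewrite memNindex ?iw // nth_default ?sw //; move: iw.
  by rewrite (perm_mem pw) mem_filter mem_iota add0n ltn_ord /= andbT lt0n => /negbT; rewrite negbK => /eqP.
have -> : count (fun w => a w == b) (inj_words N (size mu)) =
    count (fun w => map e w == mu) (permutations s).
  rewrite -!size_filter; apply/perm_size/uniq_perm.
  - by rewrite filter_uniq ?inj_words_uniq.
  - by rewrite filter_uniq ?permutations_uniq.
  by move=> w; rewrite !mem_filter mem_permutations andbC awb andbC.
case: eqP => [es|nes]; first by rewrite (count_arrangements us es) mulr_natl.
suff -> : count (fun w => map e w == mu) (permutations s) = 0%N by rewrite mulr0n.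
apply/eqP; rewrite -leqn0 leqNgt -has_count; apply/hasPn => w; rewrite mem_permutations => pw.
apply/eqP => ew; apply: nes; rewrite -ew.
apply: (@sorted_eq _ geq); first exact: geq_trans.
- by move=> x y /= /andP[h1 h2]; apply/eqP; rewrite eqn_leq h1 h2.
- by apply: sort_sorted => x y; apply: leq_total.
- by rewrite ew.
- by rewrite perm_sort perm_sym perm_map.
Qed.

(** In characteristic 0 the stabiliser order is invertible, which recovers [mono_eval] from
    [aug_mono]. *)
Lemma G_phi_content_poly (phi : symfun R) : is_symfun phi -> content_poly (G_phi phi).
Proof.
rewrite /is_symfun; elim: phi => [_|[a mu] phi IH /= /andP[pmu sphi]].
  by exists 0%N; apply: (@degle_ext _ _ (fun=> 0)) (degle_const _ _) => l _; rewrite /G_phi /symfun_eval big_nil.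
have [d dmu] := aug_mono_content_poly mu.
apply: (@content_poly_ext (fun l => a / (stab_size mu)%:R * aug_mono mu (content_alphabet l) + G_phi phi l)).
  move=> l _; rewrite /G_phi /symfun_eval big_cons /= aug_mono_eval // mulrA divfK //.
  by rewrite pnatr_eq0 -lt0n stab_size_gt0.
by apply: content_polyD (IH sphi); apply: content_poly_scale; exists d.
Qed.

End AugmentedMonomials.

Theorem theorem1 (R : realFieldType) (phi : symfun R) (hphi : is_symfun phi) :
  exists P : {poly R}, forall n : nat, (0 < n)%N ->
    planch_avg (G_phi phi) n = P.[n%:R].
Proof.
have [d /planch_avg_poly[P HP]] := G_phi_content_poly hphi.
by exists P => n _.
Qed.
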